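(* Let $k\ge 2$ and $n\ge 1$ be integers, let $t=(t_1,\dots,t_k)$ be complex numbers with $t_2\neq 0$. Let $B_{k,n}=(b_{ij})$ be the $n\times n$ lower Hessenberg matrix with $$b_{ij}=\begin{cases}-t_2 & \text{if } j=i+1,\\[1mm] \dfrac{t_{i-j+1}}{t_2^{\,i-j}} & \text{if } j\neq 1 \text{ and } 0\le i-j<k,\\[2mm] \dfrac{t_{i-j+1}}{t_2^{\,i-j}}\,(i-j+1) & \text{if } j=1 \text{ and } 0\le i-j<k,\\[2mm] 0 & \text{otherwise.}\end{cases}$$ Then $\det(B_{k,n})=G_{k,n}(t)$, where $G_{k,n}(t)$ is the generalized Lucas polynomial.
   Context: The generalized Fibonacci polynomials $F_{k,n}(t)$, $t=(t_1,\dots,t_k)$, are defined by $F_{k,n}(t)=0$ for $n<1$, $F_{k,1}(t)=1$, and $F_{k,n+1}(t)=t_1F_{k,n}(t)+\cdots+t_kF_{k,n-k+1}(t)$ for $n\ge 1$. The generalized Lucas polynomials are given by $G_{k,0}(t)=k$ and $G_{k,n}(t)=\sum_{j=1}^{k} j\,t_j\,F_{k,n-j+1}(t)$ for $n\ge 1$. A matrix $(a_{ij})$ is lower Hessenberg if $a_{ij}=0$ whenever $j-i>1$. *)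

(* Defs.v *)
From HB Require Import structures.
From mathcomp Require Import all_boot all_order all_algebra.
From mathcomp Require Import reals complex.

Set Implicit Arguments.
Unset Strict Implicit.
Unset Printing Implicit Defensive.

Import Order.TTheory GRing.Theory Num.Theory.
Local Open Scope ring_scope.

(* The parameters (t_1, ..., t_k) are a k-tuple t, so the entry t`_j is the
   mathematical t_{j+1}. *)

Section Definitions.
Variables (C : fieldType) (k : nat) (t : k.-tuple C).

(* genFib_seq m = [:: F_{k,m}; ...; F_{k,1}]; reading past the end of the
   sequence gives 0, which is the value of F_{k,i} for i < 1. *)
Fixpoint genFib_seq (m : nat) : seq C :=
  match m with
  | 0 => [::]
  | 1 => [:: 1]
  | m'.+1 => \sum_(j < k) t`_j * (genFib_seq m')`_j :: genFib_seq m'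
  end.

Definition genFib (n : int) : C :=
  match n with
  | Posz m => (genFib_seq m)`_0
  | Negz _ => 0
  end.

Lemma size_genFib_seq m : size (genFib_seq m) = m.
Proof. by elim: m => [|[|m] IHm] //=; rewrite -[in RHS]IHm. Qed.

Lemma nth_genFib_seq m j : (genFib_seq m)`_j = genFib (m%:Z - j%:Z).
Proof.
elim: m j => [|m IHm] [|j]; rewrite ?subr0 //.
have -> : m.+1%:Z - j.+1%:Z = m%:Z - j%:Z.
  by rewrite -[m.+1]addn1 -[j.+1]addn1 !PoszD opprD addrACA subrr addr0.
by rewrite -IHm; case: m {IHm} => [|m] //=; rewrite !nth_nil.
Qed.

Lemma genFib_lt1 (n : int) : n < 1 -> genFib n = 0.
Proof. by case: n => [[|m]|m]. Qed.

Lemma genFib1 : genFib 1 = 1.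
Proof. by []. Qed.

Lemma genFibS (n : int) : 1 <= n ->
  genFib (n + 1) = \sum_(j < k) t`_j * genFib (n - j%:Z).
Proof.
case: n => [[|m]|m] // _; rewrite -PoszD addn1.
by under eq_bigr => j _ do rewrite -nth_genFib_seq.
Qed.

Definition genLucas (n : nat) : C :=
  if n is 0 then k%:R
  else \sum_(j < k) j.+1%:R * t`_j * genFib (n%:Z - j%:Z).

(* Rows and columns are numbered from 0 here: i - j is unchanged, and the
   first column is j = 0. *)
Definition lucas_hessenberg (n : nat) : 'M[C]_n :=
  \matrix_(i < n, j < n)
    if j == i.+1 :> nat then - t`_1
    else if (j <= i)%N && (i - j < k)%N then
      if j != 0 :> nat then t`_(i - j) / t`_1 ^+ (i - j)
      else t`_(i - j) / t`_1 ^+ (i - j) * (i - j).+1%:R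
    else 0.

End Definitions.

Definition lower_hessenberg (C : fieldType) (n : nat) (A : 'M[C]_n) : Prop :=
  forall i j : 'I_n, (j > i.+1)%N -> A i j = 0.

Lemma lucas_hessenbergP (C : fieldType) (k : nat) (t : k.-tuple C) (n : nat) :
  lower_hessenberg (lucas_hessenberg t n).
Proof.
move=> i j lt_ij; rewrite mxE (gtn_eqF lt_ij).
by rewrite leqNgt (ltn_trans (ltnSn i) lt_ij).
Qed.

(* Main.v *)
Require Import Defs.
From mathcomp Require Import all_boot all_order all_algebra.
From mathcomp Require Import reals complex ring.

Import Order.TTheory GRing.Theory Num.Theory.
Local Open Scope ring_scope.
Local Open Scope complex_scope.

(** Put [s = t_2], which is [t`_1] in the 0-based numbering, and let
    [w] be the row vector [w_i = s^i F_(n-i)], [0 <= i < n].  The powers of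
    [s] in [w] absorb the denominators of the matrix [B], so that for [j >= 1]
    the [j]-th entry of [w B] is
      [s^j (- F_(n-j+1) + t_1 F_(n-j) + t_2 F_(n-j-1) + ...) = 0]
    by the Fibonacci recurrence, while the factors [i + 1] of the first column
    turn the entry at [0] into the Lucas sum.  Hence [w B = G_n e_0]
    ([fib_row_mul_hessenberg]).  Multiplying on the right by the adjugate gives
    [(det B) w = G_n e_0 (adj B)], and the last coordinates of the two sides are
    [s^(n-1) det B], because [F_1 = 1], and [G_n] times the cofactor of the
    bottom left corner.  Deleting the last row and the first column of a lower
    Hessenberg matrix leaves a triangular matrix whose diagonal is the
    superdiagonal [-s, ..., -s], so this cofactor is also [s^(n-1)]
    ([cofactor_hessenberg_corner]); it remains to cancel [s^(n-1)]. *)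

Lemma sum_ord_vanishing_tail (V : nmodType) (m n : nat) (a : nat -> V) :
    (forall i, (minn m n <= i)%N -> a i = 0) ->
  \sum_(i < m) a i = \sum_(i < n) a i.
Proof.
wlog le_mn : m n / (m <= n)%N => [hwlog a0|].
  case: (leqP m n) => [|/ltnW] le_mn; first exact: hwlog.
  by apply/esym/hwlog => // i; rewrite minnC; apply: a0.
rewrite (minn_idPl le_mn) => a0.
rewrite (big_ord_widen _ _ le_mn) big_mkcond /=.
by apply: eq_bigr => i _; case: ltnP => // /a0.
Qed.

Section LucasHessenberg.

Variables (C : fieldType) (k : nat) (t : k.-tuple C).

Lemma coef_overflow (l : nat) : (k <= l)%N -> t`_l = 0.
Proof. by move=> le_kl; rewrite nth_default // size_tuple. Qed.

(** The sums defining [F] and [G] run over the [k] parameters, those of a matrix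
    product over the [d] rows; [t_l = 0] for [l >= k] and [F_i = 0] for [i < 1]
    reconcile the two ranges. *)
Lemma sum_coef_genFib (d : nat) (c : nat -> C) :
  \sum_(l < k) c l * t`_l * genFib t (d%:Z - l%:Z)
  = \sum_(l < d) c l * t`_l * genFib t (d%:Z - l%:Z).
Proof.
apply: (@sum_ord_vanishing_tail _ k d
         (fun l => c l * t`_l * genFib t (d%:Z - l%:Z))) => l.
rewrite geq_min => /orP[/coef_overflow->|le_dl]; first by rewrite mulr0 mul0r.
by rewrite genFib_lt1 ?mulr0 // (le_lt_trans _ ltr01) // subr_le0 lez_nat.
Qed.

Lemma lucas_hessenbergE (n : nat) (i j : 'I_n) :
  lucas_hessenberg t n i j =
    if j == i.+1 :> nat then - t`_1
    else if (j <= i)%N then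
      (if j == 0 :> nat then (i - j).+1%:R else 1)
        * t`_(i - j) / t`_1 ^+ (i - j)
    else 0.
Proof.
rewrite mxE; case: ifP => // _.
case: (ltnP (i - j) k) => [_|/coef_overflow->]; last first.
  by rewrite andbF mulr0 mul0r if_same.
by rewrite andbT; case: eqP => _ /=; rewrite ?mul1r // mulrC mulrA.
Qed.

Definition fib_row (n : nat) : 'rV[C]_n :=
  \row_i (t`_1 ^+ i * genFib t (n%:Z - i%:Z)).

(** The weight [c] lets one computation serve both kinds of column of [B]: the
    factors [l + 1] of the first column and the factor [1] of the others.  In row
    [i = j + l] the power [s^(j+l)] of [w] cancels the denominator [s^l] and
    leaves [s^j], which does not depend on the row. *)
Lemma sum_fib_row_below (n j : nat) (c : nat -> C) :
    t`_1 != 0 -> (j <= n)%N ->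
  \sum_(i < n | (j <= i)%N)
     t`_1 ^+ i * genFib t (n%:Z - i%:Z) * (c (i - j)%N * t`_(i - j) / t`_1 ^+ (i - j))
  = t`_1 ^+ j * \sum_(l < k) c l * t`_l * genFib t ((n - j)%N%:Z - l%:Z).
Proof.
move=> s_neq0 le_jn; rewrite sum_coef_genFib mulr_sumr.
rewrite -(@big_geq_mkord _ _ _ j n xpredT (fun i => t`_1 ^+ i
  * genFib t (n%:Z - i%:Z) * (c (i - j)%N * t`_(i - j) / t`_1 ^+ (i - j)))).
rewrite -{1}[j]add0n big_addn big_mkord; apply: eq_bigr => l _.
rewrite addnK exprD -subzn // PoszD opprD addrA addrAC.
by field; rewrite expf_neq0.
Qed.

Lemma fib_row_mul_hessenberg (n : nat) : t`_1 != 0 ->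
  fib_row n.+1 *m lucas_hessenberg t n.+1 = genLucas t n.+1 *: delta_mx 0 0.
Proof.
move=> s_neq0; apply/rowP => j; rewrite !mxE eqxx /=.
under eq_bigr => i _ do rewrite mxE lucas_hessenbergE.
have [->|j_neq0] := eqVneq j 0.
  rewrite mulr1 /=.
  have /= := @sum_fib_row_below n.+1 0 (fun l => l.+1%:R) s_neq0 isT.
  by rewrite mul1r => <-.
rewrite mulr0.
case: j j_neq0 => [[|j] //= lt_jn] _.
(* Row [j] is the only one that meets column [j + 1] above the diagonal. *)
pose i0 : 'I_n.+1 := Ordinal (ltnW lt_jn).
rewrite (bigD1 i0) //= eqxx.
have -> : n.+1%:Z - j%:Z = (n.+1 - j.+1)%N%:Z + 1.
  by rewrite -subzn ?(ltnW lt_jn) // -[j.+1]addn1 PoszD opprD addrA subrK.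
rewrite genFibS; last by rewrite lez_nat subn_gt0.
set S := \sum_(l < k) _.
have below : \sum_(i < n.+1 | (j < i)%N) t`_1 ^+ i * genFib t (n.+1%:Z - i%:Z)
    * (1 * t`_(i - j.+1) / t`_1 ^+ (i - j.+1)) = t`_1 ^+ j.+1 * S.
  rewrite (@sum_fib_row_below n.+1 j.+1 (fun=> 1)) ?(ltnW lt_jn) //.
  by congr (_ * _); apply: eq_bigr => l _; rewrite mul1r.
rewrite [X in _ + X](_ : _ = t`_1 ^+ j.+1 * S); first by rewrite exprS; ring.
rewrite -below big_mkcond [RHS]big_mkcond; apply: eq_bigr => i _ /=.
rewrite eqSS -val_eqE /= [j == _]eq_sym.
by case: ltngtP => //= _; rewrite mulr0.
Qed.

(** The sign [(-1)^n] of the cofactor cancels that of the product of the [n]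
    diagonal entries [-s] of the triangular minor. *)
Lemma cofactor_hessenberg_corner (n : nat) :
  cofactor (lucas_hessenberg t n.+1) ord_max 0 = t`_1 ^+ n.
Proof.
have minorE (i j : 'I_n) :
    row' ord_max (col' 0 (lucas_hessenberg t n.+1)) i j
    = lucas_hessenberg t n.+1 (lift ord_max i) (lift 0 j) by rewrite !mxE.
rewrite /cofactor det_trig; last first.
  apply/is_trig_mxP => i j lt_ij; rewrite minorE.
  by apply: lucas_hessenbergP; rewrite lift_max.
under eq_bigr => i _ do rewrite minorE lucas_hessenbergE lift_max /= eqxx.
by rewrite prodr_const card_ord addn0 -exprMn mulN1r opprK.
Qed.

Theorem det_lucas_hessenberg (n : nat) : t`_1 != 0 ->
  \det (lucas_hessenberg t n.+1) = genLucas t n.+1.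
Proof.
move=> s_neq0; set B := lucas_hessenberg t n.+1.
have /rowP/(_ ord_max) : fib_row n.+1 *m (B *m \adj B)
    = genLucas t n.+1 *: delta_mx 0 0 *m \adj B.
  by rewrite mulmxA fib_row_mul_hessenberg.
rewrite mul_mx_adj mul_mx_scalar -scalemxAl -rowE !mxE.
rewrite cofactor_hessenberg_corner.
have -> : n.+1%:Z - n%:Z = 1 by rewrite -[n.+1]addn1 PoszD addrC addKr.
rewrite genFib1 mulr1; apply: mulIf; exact: expf_neq0.
Qed.

End LucasHessenberg.

Theorem theorem2p4 (R : realType) (k n : nat) (t : k.-tuple R[i])
    (hk : (2 <= k)%N) (hn : (1 <= n)%N) (ht2 : t`_1 != 0) :
  \det (lucas_hessenberg t n) = genLucas t n.
Proof. by case: n hn => // n _; apply: det_lucas_hessenberg. Qed.
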